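(* If $D\subseteq W$ is a closed Condorcet domain, then its associated graph $G_D$ is a median graph.
   Context: Let $\Phi$ be a finite root system in a real Euclidean space (a finite set of nonzero vectors with $\Phi\cap\mathbb{R}\alpha=\{\alpha,-\alpha\}$ and $s_\alpha(\Phi)=\Phi$ for all $\alpha\in\Phi$, where $s_\alpha$ is the orthogonal reflection in $\alpha^\perp$; not necessarily crystallographic). Let $\Phi^+$ be a choice of positive roots, $\Phi^-=\Phi\setminus\Phi^+$, and let $W=W(\Phi)$ be the finite Coxeter group generated by the $s_\alpha$. For $w\in W$, the (left) inversion set is $I(w):=\{\alpha\in\Phi\mid w^{-1}\alpha\in\Phi^-\}$ (negative roots are allowed, so exactly one of $\alpha,-\alpha$ lies in $I(w)$). A set of three roots $\{\alpha,\beta,\gamma\}\subseteq\Phi$ is a root-triple if there exist real $a,b,c>0$ with $a\alpha+b\beta+c\gamma=0$. A nonempty subset $D\subseteq W$ is a Condorcet domain if there do not exist distinct $u,v,w\in D$ and a root-triple $\{\alpha,\beta,\gamma\}$ such that $\alpha,\beta\in I(u)$, $\alpha,\gamma\in I(v)$, $\beta,\gamma\in I(w)$. A voting profile on $D$ is a map $f:D\to\mathbb{Z}_{\ge0}$, not constantly zero. Put $f(\alpha)=\sum_{w\in D,\ \alpha\in I(w)}f(w)$ for $\alpha\in\Phi$, $|f|=\sum_{w\in D}f(w)$, $I(f)=\{\alpha\in\Phi\mid f(\alpha)\ge|f|/2\}$ and $R(f)=\{w\in W\mid I(w)\subseteq I(f)\}$. $f$ has no tie if $f(\alpha)\ne|f|/2$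 for all $\alpha\in\Phi$. Let $\nu(D)=\bigcup_f R(f)$ over all voting profiles $f$ on $D$ with no tie. A Condorcet domain $D$ is closed if $\nu(D)=D$ (equivalently $\nu(D)\subseteq D$). Two distinct elements $v_1,v_2\in D$ are neighbors if there is no $v\in D\setminus\{v_1,v_2\}$ with $I(v)\supseteq I(v_1)\cap I(v_2)$. The associated graph $G_D$ is the simple graph with vertex set $D$ and edge set $\{\{v_1,v_2\}\mid v_1,v_2\text{ are neighbors}\}$. A simple graph $G$ is a median graph if for any three vertices $a,b,c$ there is a unique vertex $v$ that lies on a shortest path between each pair of $a,b,c$; equivalently, a unique $v$ with $d(a,b)=d(a,v)+d(v,b)$, $d(b,c)=d(b,v)+d(v,c)$ and $d(c,a)=d(c,v)+d(v,a)$, where $d$ is the number of edges in a shortest path. *)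

(* Defs.v *)
From HB Require Import structures.
From mathcomp Require Import all_boot all_order all_algebra.
From mathcomp Require Import finmap boolp classical_sets reals.

Set Implicit Arguments.
Unset Strict Implicit.
Unset Printing Implicit Defensive.

Import Order.TTheory GRing.Theory Num.Theory.

Local Open Scope fset_scope.
Local Open Scope classical_set_scope.
Local Open Scope ring_scope.

Section RootSystem.
Variables (R : realType) (n : nat).
Implicit Types (Phi Phip : {fset 'cV[R]_n}) (D : {fset 'M[R]_n}).
Implicit Types (u w : 'M[R]_n) (a b c x y : 'cV[R]_n).

Definition dotv x y : R := \sum_(i < n) x i 0 * y i 0.

(* The matrix of s_a; see reflmxE. *)
Definition reflmx a : 'M[R]_n := 1%:M - (2 / dotv a a) *: (a *m a^T).

Lemma reflmxE a x : reflmx a *m x = x - (2 * dotv x a / dotv a a) *: a.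
Proof.
have E : a^T *m x = (dotv x a)%:M.
  rewrite [LHS]mx11_scalar; congr (_%:M); rewrite mxE.
  by apply: eq_bigr => i _; rewrite mxE mulrC.
by rewrite /reflmx mulmxBl mul1mx -scalemxAl -mulmxA E mul_mx_scalar scalerA mulrAC.
Qed.

Definition root_system Phi : Prop :=
  [/\ 0 \notin Phi,
      forall a, a \in Phi ->
        [set` Phi] `&` [set t *: a | t in [set: R]] = [set a; - a]
    & forall a, a \in Phi -> [fset reflmx a *m b | b in Phi]%fset = Phi].

(* Positive systems are cut out by a linear form vanishing on no root. *)
Definition positive_system Phi Phip : Prop :=
  exists l : 'cV[R]_n,
    (forall a, a \in Phi -> dotv l a != 0) /\
    Phip = [fset a in Phi | 0 < dotv l a]%fset.

(* The subgroup of GL_n(R) generated by the reflections s_a, a in Phi. *)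
Inductive in_refl_group Phi : 'M[R]_n -> Prop :=
| RG_one : in_refl_group Phi 1%:M
| RG_gen a : a \in Phi -> in_refl_group Phi (reflmx a)
| RG_mul u v : in_refl_group Phi u -> in_refl_group Phi v ->
    in_refl_group Phi (u *m v)
| RG_inv u : in_refl_group Phi u -> in_refl_group Phi (invmx u).

Definition refl_group Phi : set 'M[R]_n := [set w | in_refl_group Phi w].

Definition inversions Phi Phip w : {fset 'cV[R]_n} :=
  [fset a in Phi | invmx w *m a \in Phi `\` Phip]%fset.

Definition root_triple Phi a b c : Prop :=
  [/\ [/\ a \in Phi, b \in Phi & c \in Phi],
      [/\ a != b, a != c & b != c]
    & exists r s t : R, [/\ 0 < r, 0 < s, 0 < t
                          & r *: a + s *: b + t *: c = 0]].

Definition condorcet_domain Phi Phip D : Prop :=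
  [/\ D != fset0,
      [set` D] `<=` refl_group Phi
    & ~ exists (u v w : 'M[R]_n) (a b c : 'cV[R]_n),
        [/\ [/\ u \in D, v \in D & w \in D],
            [/\ u != v, u != w & v != w],
            root_triple Phi a b c
          & [/\ [fset a; b] `<=` inversions Phi Phip u,
                [fset a; c] `<=` inversions Phi Phip v
              & [fset b; c] `<=` inversions Phi Phip w]%fset]].

Definition voting_profile D (f : D -> nat) : Prop := exists w : D, f w != 0%N.

Definition votes Phi Phip D (f : D -> nat) a : nat :=
  \sum_(w : D | a \in inversions Phi Phip (val w)) f w.

Definition total_votes D (f : D -> nat) : nat := \sum_(w : D) f w.

Definition majority Phi Phip D (f : D -> nat) : {fset 'cV[R]_n} :=
  [fset a in Phi |
     (total_votes f)%:R / 2 <= (votes Phi Phip f a)%:R :> R]%fset.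

Definition majority_elements Phi Phip D (f : D -> nat) : set 'M[R]_n :=
  [set w | refl_group Phi w /\
           (inversions Phi Phip w `<=` majority Phi Phip f)%fset].

Definition no_tie Phi Phip D (f : D -> nat) : Prop :=
  forall a, a \in Phi ->
    (votes Phi Phip f a)%:R != (total_votes f)%:R / 2 :> R.

Definition nu Phi Phip D : set 'M[R]_n :=
  \bigcup_(f in [set f : D -> nat | voting_profile f /\ no_tie Phi Phip f])
    majority_elements Phi Phip f.

Definition closed_condorcet_domain Phi Phip D : Prop :=
  condorcet_domain Phi Phip D /\ nu Phi Phip D = [set` D].

Definition neighbors Phi Phip D : rel D := fun v1 v2 =>
  (v1 != v2) &&
  ~~ [exists v : D,
      [&& v != v1, v != v2
        & (inversions Phi Phip (val v1) `&` inversions Phi Phip (val v2)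
             `<=` inversions Phi Phip (val v))%fset]].

Lemma neighbors_sym Phi Phip D : symmetric (@neighbors Phi Phip D).
Proof.
move=> v1 v2; rewrite /neighbors eq_sym; congr (_ && ~~ _).
by apply: eq_existsb => v; rewrite andbCA fsetIC.
Qed.

Lemma neighbors_irrefl Phi Phip D : irreflexive (@neighbors Phi Phip D).
Proof. by move=> v; rewrite /neighbors eqxx. Qed.

End RootSystem.

Record sgraph := SGraph {
  vertex : finType;
  edge : rel vertex;
  edge_sym : symmetric edge;
  edge_irrefl : irreflexive edge }.

Definition assoc_graph (R : realType) (n : nat) (Phi Phip : {fset 'cV[R]_n})
    (D : {fset 'M[R]_n}) : sgraph :=
  SGraph (@neighbors_sym R n Phi Phip D) (@neighbors_irrefl R n Phi Phip D).

Section Median.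
Variable G : sgraph.
Implicit Types (x y v : vertex G) (p q : seq (vertex G)).

(* The path is x :: p, so that size p is its number of edges. *)
Definition shortest_path x y p : Prop :=
  [/\ path (@edge G) x p, last x p = y
    & forall q, path (@edge G) x q -> last x q = y -> (size p <= size q)%N].

Definition on_shortest_path x y v : Prop :=
  exists2 p, shortest_path x y p & v \in x :: p.

Definition median_graph : Prop :=
  forall a b c : vertex G, exists! v,
    [/\ on_shortest_path a b v, on_shortest_path b c v
      & on_shortest_path c a v].

End Median.

(* Main.v *)
Require Import Defs.
From mathcomp Require Import all_boot all_order all_algebra.
From mathcomp Require Import finmap boolp classical_sets reals.
From mathcomp Require Import fintype finset finmap.
From mathcomp Require Import ring lra.

(** The proof separates a combinatorial part from a geometric one.

    Combinatorially, each root a cuts D into the halfspace of those w with a in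
    I(w) and its complement, which is the halfspace of - a.  A vertex v lies
    above I(v1) :&: I(v2) exactly when no halfspace has v1 and v2 on one side
    and v on the other, so neighbors are pairs with nothing strictly between
    them.  If the halfspaces separate the points of D and any three points have
    a median (a point taking, for each halfspace, the side chosen by at least
    two of the three), then neighbors are separated by exactly one halfspace.
    Hence the distance in the graph counts separating halfspaces, lying on a
    shortest path means lying between, and the median of three points is the
    vertex required of a median graph: [halfspaces_median_graph].  Counting
    halfspaces as subsets of D, not as roots, is what makes this work: many
    roots may cut D in the same way.

    Geometrically, two facts are needed.

    Medians exist ([domain_median]).  Give one vote to each of u, v, w: three
    votes cannot tie, and by the Condorcet condition the majority set S contains
    no root-triple.  It also contains exactly one of a, - a for each root a.
    Such an S is an inversion set ([polar_inversions]): the sum rho of the roots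
    in S has positive inner product with every root of S, and an element w of W
    minimising the value at w rho of the linear form that defines the positive
    roots must send all of S to negative roots.  As D is closed, the element of
    W with inversion set S belongs to D.

    Inversion sets separate the points of D ([inversions_inj]), which is the
    statement that W acts freely on the positive systems
    ([refl_group_free]).  As usual this is deduced from the generation of W by
    simple reflections and the exchange property.  Here a simple root is by
    definition a positive root whose reflection permutes the other positive
    roots. *)

Set Implicit Arguments.
Unset Strict Implicit.
Unset Printing Implicit Defensive.

Import Order.TTheory GRing.Theory Num.Theory.

(** * Median graphs from families of halfspaces *)

Section HalfspaceGraph.
Variables (G : sgraph) (Hs : {set {set vertex G}}).
Implicit Types (a b c v x y : vertex G) (p q : seq (vertex G)).

Definition separators a b : {set {set vertex G}} :=
  [set H in Hs | (a \in H) && (b \notin H)].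

Definition between a b v : bool :=
  [forall H in Hs, (a \in H) && (b \in H) ==> (v \in H)].

Hypothesis HsC : forall H, H \in Hs -> ~: H \in Hs.
Hypothesis Hs_separate :
  forall a b, (forall H, H \in Hs -> a \in H -> b \in H) -> a = b.
Hypothesis Hs_median : forall a b c, exists m, forall H, H \in Hs ->
  (m \in H) = [|| (a \in H) && (b \in H), (b \in H) && (c \in H)
                | (c \in H) && (a \in H)].
Hypothesis edgeE : forall a b, edge a b =
  (a != b) && ~~ [exists v, [&& v != a, v != b & between a b v]].

Lemma betweenP a b v :
  reflect (forall H, H \in Hs -> a \in H -> b \in H -> v \in H)
          (between a b v).
Proof.
apply: (iffP forall_inP) => [ab H HH aH bH | ab H HH].
  by have /implyP := ab H HH; rewrite aH bH; apply.
by apply/implyP => /andP[]; apply: ab.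
Qed.

Lemma separators_eq0 a b : separators a b = set0 -> a = b.
Proof.
move=> ab0; apply: Hs_separate => H HH aH; apply/negP => /negP bH.
by have := in_set0 H; rewrite -ab0 inE HH aH bH.
Qed.

(** A halfspace separating a from b separates a from v or v from b, according
    to the side of v, and no halfspace does both.  Equality fails exactly when
    some halfspace separates v from both a and b; closure under complements is
    used to orient such a halfspace towards a and b. *)
Lemma separators_triangle a v b :
  #|separators a b| <= #|separators a v| + #|separators v b| ?= iff
    between a b v.
Proof.
have disj : [disjoint separators a v & separators v b].
  rewrite -setI_eq0; apply/eqP/setP => H; rewrite !inE.
  by apply/negP => /andP[/and3P[_ _ /negbTE ->] /and3P[]].
have <- : #|separators a v :|: separators v b|
            = #|separators a v| + #|separators v b|.
  by rewrite cardsU disjoint_setI0 // cards0 subn0.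
have sub : separators a b \subset separators a v :|: separators v b.
  apply/subsetP => H; rewrite !inE => /and3P[-> -> ->].
  by rewrite andbT /= orNb.
have [le_ab eq_ab] := subset_leqif_cards sub.
split=> //; rewrite eq_ab; apply/eqP/betweenP => [eqs H HH aH bH | btw].
  apply/negP => /negP vH; move/setP/(_ H): eqs.
  by rewrite !inE HH aH bH vH.
apply/eqP; rewrite eqEsubset sub /=; apply/subsetP => H; rewrite !inE.
case/orP => /and3P[HH inH ninH]; rewrite HH.
  by rewrite inH /=; apply: contra ninH; apply: btw.
rewrite ninH andbT /=; apply: contraLR inH => aH.
by have := btw (~: H) (HsC HH); rewrite !inE; apply.
Qed.

Lemma edge_separators a b : edge a b -> #|separators a b| <= 1.
Proof.
rewrite edgeE => /andP[_ /existsPn nobtw].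
(* no vertex lies in a halfspace H but not in another H', both separating
   a from b: its median with a and b would lie strictly between them *)
have sub H H' : H \in separators a b -> H' \in separators a b ->
    H \subset H'.
  rewrite !inE => /and3P[HH aH bH] /and3P[HH' aH' bH'].
  apply/subsetP => x xH; apply/negP => /negP xH'.
  have [m mE] := Hs_median a b x.
  have /negP := nobtw m; apply; apply/and3P; split.
  - apply: contraNneq xH' => ma; have := mE _ HH'.
    by rewrite ma aH' (negbTE bH') /= andbT => <-.
  - apply: contraNneq bH => mb; have := mE _ HH.
    by rewrite mb aH xH !orbT.
  - by apply/betweenP => K KK aK bK; rewrite mE // aK bK.
apply/card_le1_eqP => H H' HH HH'.
by apply/eqP; rewrite eqEsubset !sub.
Qed.

Lemma path_separators x p :
  path (@edge G) x p -> #|separators x (last x p)| <= size p.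
Proof.
elim: p x => [|y p IHp] x /= => [_ | /andP[exy /IHp le_p]].
  rewrite leqn0 cards_eq0; apply/eqP/setP => H.
  by rewrite !inE andbN andbF.
apply: leq_trans (separators_triangle x y _) _.
by rewrite -add1n leq_add // edge_separators.
Qed.

(** Insert points strictly between a and b until consecutive ones are
    neighbors; the numbers of separators add up along the way. *)
Lemma path_of_separators a b :
  exists p, [/\ path (@edge G) a p, last a p = b & size p = #|separators a b|].
Proof.
move: {2}(#|separators a b|).+1 (ltnSn #|separators a b|) => k.
elim: k a b => // k IHk a b; rewrite ltnS => le_k.
have [<- | neq_ab] := eqVneq a b.
  exists [::]; split=> //=; apply/esym/eqP; rewrite cards_eq0.
  by apply/eqP/setP => H; rewrite !inE andbN andbF.
have pos u v : u != v -> 0 < #|separators u v|.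
  by move=> uv; rewrite card_gt0; apply: contraNneq uv => /separators_eq0 ->.
have [eab | ] := boolP (edge a b).
  exists [:: b]; split=> //=; first by rewrite eab.
  by apply/eqP; rewrite eq_sym eqn_leq edge_separators // pos.
rewrite edgeE neq_ab negbK => /existsP[v /and3P[va vb btw]].
have /leqifP := separators_triangle a v b; rewrite btw => /eqP eq_ab.
have av := pos a v; rewrite eq_sym va in av.
have [p [p1 p2 p3]] : exists p,
    [/\ path (@edge G) a p, last a p = v & size p = #|separators a v|].
  apply: IHk; apply: leq_trans le_k.
  by rewrite eq_ab -addn1 leq_add2l pos.
have [q [q1 q2 q3]] : exists p,
    [/\ path (@edge G) v p, last v p = b & size p = #|separators v b|].
  apply: IHk; apply: leq_trans le_k.
  by rewrite eq_ab -add1n leq_add2r av.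
exists (p ++ q); rewrite cat_path last_cat size_cat p2 p3 q3 eq_ab.
by rewrite p1 q1.
Qed.

Lemma shortest_path_separators x y p : shortest_path x y p ->
  size p = #|separators x y|.
Proof.
case=> xp <- minp; apply/eqP; rewrite eqn_leq path_separators // andbT.
have [q [xq lq <-]] := path_of_separators x (last x p).
exact: minp.
Qed.

Lemma on_shortest_pathE x y v : on_shortest_path x y v <-> between x y v.
Proof.
split=> [[p sp vp] | btw].
  have := shortest_path_separators sp; case: sp => xp lp _.
  case/splitPl: vp xp lp => p1 p2 lv.
  rewrite cat_path last_cat lv size_cat => /andP[xp1 vp2] lp eq_size.
  have [_ <-] := separators_triangle x v y.
  rewrite eqn_leq separators_triangle /= -eq_size -{1}lv -lp.
  by apply: leq_add; apply: path_separators.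
have [p [p1 p2 p3]] := path_of_separators x v.
have [q [q1 q2 q3]] := path_of_separators v y.
exists (p ++ q); last by rewrite -cat_cons mem_cat -p2 mem_last.
split=> [||r xr lr]; rewrite ?cat_path ?last_cat ?p2 ?p1 //.
rewrite size_cat p3 q3.
have /leqifP := separators_triangle x v y; rewrite btw => /eqP <-.
by rewrite -lr path_separators.
Qed.

Lemma halfspaces_median_graph : median_graph G.
Proof.
move=> a b c; have [m mE] := Hs_median a b c; exists m; split.
  by split; apply/on_shortest_pathE/betweenP => H HH h1 h2;
    rewrite mE // h1 h2 ?orbT.
move=> v [/on_shortest_pathE/betweenP ab /on_shortest_pathE/betweenP bc].
move=> /on_shortest_pathE/betweenP ca.
apply: Hs_separate => H HH; rewrite mE //.
by case/or3P => /andP[]; [apply: ab | apply: bc | apply: ca].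
Qed.

End HalfspaceGraph.

Local Open Scope ring_scope.

(** * The inner product *)

Section InnerProduct.
Variables (R : realType) (n : nat).
Implicit Types (x y z a : 'cV[R]_n) (u : 'M[R]_n).

Lemma dotvC x y : dotv x y = dotv y x.
Proof. by apply: eq_bigr => i _; rewrite mulrC. Qed.

Lemma dotvDr x y z : dotv x (y + z) = dotv x y + dotv x z.
Proof. by rewrite -big_split /=; apply: eq_bigr => i _; rewrite mxE mulrDr. Qed.

Lemma dotvZr t x y : dotv x (t *: y) = t * dotv x y.
Proof. by rewrite mulr_sumr; apply: eq_bigr => i _; rewrite mxE mulrCA. Qed.

Lemma dotvNr x y : dotv x (- y) = - dotv x y.
Proof. by rewrite -scaleN1r dotvZr mulN1r. Qed.

Lemma dotvBr x y z : dotv x (y - z) = dotv x y - dotv x z.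
Proof. by rewrite dotvDr dotvNr. Qed.

Lemma dotv0r x : dotv x 0 = 0.
Proof. by rewrite -(scale0r 0) dotvZr mul0r. Qed.

Lemma dotvDl x y z : dotv (y + z) x = dotv y x + dotv z x.
Proof. by rewrite !(dotvC _ x) dotvDr. Qed.

Lemma dotvZl t x y : dotv (t *: y) x = t * dotv y x.
Proof. by rewrite !(dotvC _ x) dotvZr. Qed.

Lemma dotvNl x y : dotv (- y) x = - dotv y x.
Proof. by rewrite !(dotvC _ x) dotvNr. Qed.

Lemma dotvBl x y z : dotv (y - z) x = dotv y x - dotv z x.
Proof. by rewrite dotvDl dotvNl. Qed.

Lemma dotv_sumr (I : finType) (P : pred I) (F : I -> 'cV[R]_n) x :
  dotv x (\sum_(i | P i) F i) = \sum_(i | P i) dotv x (F i).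
Proof. exact: (big_morph _ (dotvDr x) (dotv0r x)). Qed.

Lemma dotvE x y : dotv x y = (x^T *m y) 0 0.
Proof. by rewrite mxE; apply: eq_bigr => i _; rewrite mxE. Qed.

Lemma dotv_mulmxl u x y : dotv (u *m x) y = dotv x (u^T *m y).
Proof. by rewrite !dotvE trmx_mul mulmxA. Qed.

Lemma dotv_gt0 x : x != 0 -> 0 < dotv x x.
Proof.
move=> /cV0Pn[i xi]; rewrite lt_def sumr_ge0 => [|j _]; last exact: sqr_ge0.
rewrite andbT psumr_neq0 => [|j _]; last exact: sqr_ge0.
by apply/hasP; exists i; rewrite ?mem_index_enum //= -expr2 exprn_even_gt0.
Qed.

Lemma CauchySchwarz_lt x a : (forall t, x != t *: a) -> a != 0 ->
  dotv x a ^+ 2 < dotv x x * dotv a a.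
Proof.
move=> xa /dotv_gt0 aa.
have := dotv_gt0 (x := x - (dotv x a / dotv a a) *: a).
rewrite subr_eq0 => /(_ (xa _)).
rewrite dotvBr !dotvBl !dotvZr !dotvZl (dotvC a x).
rewrite -(pmulr_rgt0 _ aa); set d := dotv x a; set A := dotv a a.
have -> : A * (dotv x x - d / A * d - (d / A * d - d / A * (d / A * A)))
  = dotv x x * A - d ^+ 2 by field; exact: lt0r_neq0.
by rewrite subr_gt0.
Qed.

End InnerProduct.

(** * Reflections and orthogonal matrices *)

Section Reflections.
Variables (R : realType) (n : nat).
Implicit Types (x y a b : 'cV[R]_n) (u : 'M[R]_n).

Lemma tr_reflmx a : (reflmx a)^T = reflmx a.
Proof. by rewrite /reflmx linearB linearZ /= trmx_mul trmxK trmx1. Qed.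

Lemma reflmxN a : reflmx (- a) = reflmx a.
Proof.
by rewrite /reflmx dotvNl dotvNr opprK linearN /= mulmxN mulNmx opprK.
Qed.

Lemma reflmx_self a : a != 0 -> reflmx a *m a = - a.
Proof.
move=> /dotv_gt0/lt0r_neq0 aa; rewrite reflmxE -mulrA divff // mulr1.
by rewrite scaler_nat mulr2n opprD addrA subrr sub0r.
Qed.

Lemma dotv_refl_root a x : a != 0 -> dotv (reflmx a *m x) a = - dotv x a.
Proof. by move=> a0; rewrite dotv_mulmxl tr_reflmx reflmx_self // dotvNr. Qed.

Lemma reflmxK a x : a != 0 -> reflmx a *m (reflmx a *m x) = x.
Proof.
move=> a0; rewrite [LHS]reflmxE dotv_refl_root // reflmxE.
by rewrite mulrN mulNr scaleNr opprK subrK.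
Qed.

Lemma col_mulmx_eq u v : (forall x : 'cV[R]_n, u *m x = v *m x) -> u = v.
Proof.
move=> uv; apply/matrixP => i j.
by have /colP/(_ i) := uv (delta_mx j 0); rewrite -!colE !mxE.
Qed.

Lemma reflmxM a : a != 0 -> reflmx a *m reflmx a = 1%:M.
Proof.
by move=> a0; apply: col_mulmx_eq => x; rewrite -mulmxA reflmxK // mul1mx.
Qed.

Lemma orthogonal_trmx u : u^T *m u = 1%:M -> u *m u^T = 1%:M.
Proof. exact: mulmx1C. Qed.

Lemma orthogonal_invmx u : u^T *m u = 1%:M -> invmx u = u^T.
Proof.
move=> uu; have /mulmx1_unit[_ U] := uu.
by rewrite -[LHS]mul1mx -uu -mulmxA mulmxV // mulmx1.
Qed.

Lemma dotv_orthogonal u x y : u^T *m u = 1%:M ->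
  dotv (u *m x) (u *m y) = dotv x y.
Proof. by move=> uu; rewrite dotv_mulmxl mulmxA uu mul1mx. Qed.

Lemma reflmx_conj u a : u^T *m u = 1%:M ->
  reflmx (u *m a) = u *m reflmx a *m u^T.
Proof.
move=> uu; rewrite /reflmx dotv_orthogonal // mulmxBr mulmxBl mulmx1.
by rewrite mulmx1C // -scalemxAr -scalemxAl trmx_mul !mulmxA.
Qed.

End Reflections.

(** * Root systems *)

Lemma finite_minimum (R : realType) (T : finType) (P : T -> Prop) (f : T -> R) :
  (exists x, P x) -> exists2 x, P x & forall y, P y -> f x <= f y.
Proof.
case=> x0 /asboolP Px0.
case: (arg_minP f (P := fun x => `[<P x>]) Px0) => x /asboolP Px minx.
by exists x => // y /asboolP; apply: minx.
Qed.

Section RootSystem.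
Local Open Scope fset_scope.
Local Open Scope ring_scope.
Variables (R : realType) (n : nat) (Phi : {fset 'cV[R]_n}).
Implicit Types (a b c x y : 'cV[R]_n) (u v w : 'M[R]_n).
Hypothesis Phi_roots : root_system Phi.

Lemma root_neq0 a : a \in Phi -> a != 0.
Proof. by case: Phi_roots => Phi0 _ _ aP; apply: contraNneq Phi0 => <-. Qed.

Lemma root_proportional a t : a \in Phi -> t *: a \in Phi ->
  t *: a = a \/ t *: a = - a.
Proof.
case: Phi_roots => _ Phil _ aP taP; have := Phil a aP.
move/(congr1 (fun A => A (t *: a))) => /= <-.
by split => //; exists t.
Qed.

Lemma root_opp a : a \in Phi -> - a \in Phi.
Proof.
case: Phi_roots => _ Phil _ aP.
have : [set a; - a]%classic (- a) by right.
by rewrite -Phil // => -[].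
Qed.

Lemma root_refl a b : a \in Phi -> b \in Phi -> reflmx a *m b \in Phi.
Proof.
case: Phi_roots => _ _ Phis aP bP; rewrite -(Phis a aP).
by apply/imfsetP; exists b.
Qed.

Lemma refl_groupP u : in_refl_group Phi u ->
  u^T *m u = 1%:M /\ forall a, (u *m a \in Phi) = (a \in Phi).
Proof.
elim=> {u} [|a aP|u v _ [uu uP] _ [vv vP]|u _ [uu uP]].
- by split=> [|a]; rewrite ?trmx1 mul1mx.
- have a0 := root_neq0 aP; split=> [|b]; first by rewrite tr_reflmx reflmxM.
  apply/idP/idP => [|bP]; last exact: root_refl.
  by move/(root_refl aP); rewrite reflmxK.
- split=> [|a]; last by rewrite -mulmxA uP vP.
  by rewrite trmx_mul mulmxA -(mulmxA v^T) uu mulmx1.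
- rewrite orthogonal_invmx // trmxK mulmx1C //; split=> // a.
  by rewrite -[LHS]uP mulmxA mulmx1C // mul1mx.
Qed.

Lemma refl_group_orth u : in_refl_group Phi u -> u^T *m u = 1%:M.
Proof. by case/refl_groupP. Qed.

Lemma refl_group_root u a : in_refl_group Phi u ->
  (u *m a \in Phi) = (a \in Phi).
Proof. by case/refl_groupP. Qed.


(** * Root-triple-free choices of one root from each opposite pair *)

Section Polarization.
Variable S : {fset 'cV[R]_n}.
Hypothesis S_sub : S `<=` Phi.
Hypothesis S_polar : forall a, a \in Phi -> (- a \in S) = (a \notin S).
Hypothesis S_no_triple :
  forall a b c, a \in S -> b \in S -> c \in S -> ~ root_triple Phi a b c.

(** Roots in S that are proportional are equal, since S omits the opposite.
    This gives the distinctness that is part of a root-triple for free in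
    [polar_no_relation3]. *)
Lemma polar_no_relation2 a b r s : a \in S -> b \in S -> 0 < r -> 0 < s ->
  r *: a + s *: b <> 0.
Proof.
move=> aS bS r0 s0 ab0.
have [aP bP] := (fsubsetP S_sub _ aS, fsubsetP S_sub _ bS).
have bE : b = (- (r / s)) *: a.
  apply: (scalerI (lt0r_neq0 s0)).
  rewrite scalerA mulrN mulrC divfK ?lt0r_neq0 //.
  by rewrite scaleNr; apply/eqP; rewrite -addr_eq0 addrC ab0.
have := bP; rewrite bE => /(root_proportional aP); rewrite -bE => -[] ba.
  move: ab0; rewrite ba -scalerDl => /eqP.
  by rewrite scaler_eq0 (negbTE (root_neq0 aP)) orbF gt_eqF // addr_gt0.
by move: bS; rewrite ba S_polar // aS.
Qed.

Lemma polar_no_relation3 a b c r s t : a \in S -> b \in S -> c \in S ->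
  0 < r -> 0 < s -> 0 < t -> r *: a + s *: b + t *: c <> 0.
Proof.
move=> aS bS cS r0 s0 t0 abc0.
have SP := fsubsetP S_sub.
apply: (S_no_triple aS bS cS).
split; [by split; apply: SP | | by exists r, s, t].
split; apply/eqP => E; move: abc0; rewrite E.
- by rewrite -scalerDl; apply: polar_no_relation2 => //; apply: addr_gt0.
- rewrite addrAC -scalerDl.
  by apply: polar_no_relation2 => //; apply: addr_gt0.
- rewrite -addrA -scalerDl.
  by apply: polar_no_relation2 => //; apply: addr_gt0.
Qed.

(** Pair each root x of S with its reflection y in b.  If y is also in S, the
    contributions of x and y cancel.  Otherwise - y is in S and x - y is a
    multiple of b, whose coefficient has the sign of the inner product of x
    and b; were it negative, x, - y and b would form a root-triple in S. *)
Lemma polar_sum_gt0 b : b \in S ->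
  0 < dotv (\sum_(x : Phi | val x \in S) val x) b.
Proof.
move=> bS; have bP := fsubsetP S_sub _ bS; have b0 := root_neq0 bP.
pose sb (x : Phi) : Phi := [` root_refl bP (fsvalP x)].
have sbK : involutive sb by move=> x; apply: val_inj; rewrite /= reflmxK.
rewrite dotvC dotv_sumr (bigID (fun x : Phi => val (sb x) \in S)) /=.
(* A collects the x whose reflection stays in S: reindexing by the
   reflection changes its sign *)
set A := (X in X + _).
have A0 : A = 0.
  have AN : A = - A.
    rewrite {1}/A (reindex_inj (inv_inj sbK)) -sumrN /=.
    apply: eq_big => [x | x _]; first by rewrite reflmxK // andbC.
    by rewrite dotvC dotv_refl_root // dotvC.
  lra.
rewrite A0 add0r.
have pos (x : Phi) : val x \in S -> reflmx b *m val x \notin S ->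
    0 < dotv b (val x).
  move=> xS sxS; rewrite ltNge; apply/negP => bx.
  have sxP : reflmx b *m val x \in Phi by apply: root_refl => //; apply: valP.
  have sxS' : - (reflmx b *m val x) \in S by rewrite S_polar.
  have E : val x - reflmx b *m val x
      + (- (2 * dotv b (val x) / dotv b b)) *: b = 0.
    by rewrite reflmxE subKr (dotvC b) scaleNr subrr.
  move: bx; rewrite le_eqVlt => /orP[/eqP bx | bx].
    by move: sxS; rewrite reflmxE dotvC bx mulr0 mul0r scale0r subr0 xS.
  have := polar_no_relation3 xS sxS' bS ltr01 ltr01 _; rewrite !scale1r.
  move=> /(_ (- (2 * dotv b (val x) / dotv b b))); rewrite E; case=> //.
  by rewrite oppr_gt0 pmulr_llt0 ?invr_gt0 ?dotv_gt0 // pmulr_rlt0.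
rewrite (bigD1 [` bP]) /=; last first.
  by rewrite bS reflmx_self // S_polar // bS.
apply: ltr_wpDr; last exact: dotv_gt0.
by apply: sumr_ge0 => x /andP[/andP[xS sxS] _]; apply/ltW/pos.
Qed.

Variable l : 'cV[R]_n.
Hypothesis l_regular : forall a, a \in Phi -> dotv l a != 0.

(** Let w minimise the value of the form l at w rho, rho being the sum of S.  If
    b in S had l (w b) > 0, reflecting in w b would subtract from w rho a
    positive multiple of w b, by [polar_sum_gt0], and lower the value.  A
    minimum exists because l (w rho) depends only on the self-map of the finite
    set Phi that w induces, so these self-maps are what is minimised over. *)
Lemma polar_inversions : exists2 w, in_refl_group Phi w &
  forall a, a \in Phi -> (a \in S) = (dotv l (invmx w *m a) < 0).
Proof.
pose P (g : {ffun Phi -> Phi}) := exists2 w, in_refl_group Phi w &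
  forall x : Phi, val (g x) = w *m val x.
pose F (g : {ffun Phi -> Phi}) :=
  \sum_(x : Phi | val x \in S) dotv l (val (g x)).
have [|g [w wW gE] gmin] := @finite_minimum R _ P F.
  exists [ffun x : Phi => x]; exists 1%:M; first exact: RG_one.
  by move=> x; rewrite ffunE mul1mx.
set rho := \sum_(x : Phi | val x \in S) val x.
have FE (h : {ffun Phi -> Phi}) u : (forall x : Phi, val (h x) = u *m val x) ->
    F h = dotv (u^T *m l) rho.
  move=> hE; rewrite dotv_sumr; apply: eq_bigr => x _.
  by rewrite dotv_mulmxl trmxK hE.
have wneg b : b \in S -> dotv l (w *m b) < 0.
  move=> bS; have bP := fsubsetP S_sub _ bS.
  have wbP : w *m b \in Phi by rewrite refl_group_root.
  rewrite lt_def; rewrite eq_sym l_regular //= leNgt; apply/negP => lwb.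
  have sW : in_refl_group Phi (reflmx (w *m b) *m w).
    by apply: RG_mul => //; apply: RG_gen.
  have sP (x : Phi) : (reflmx (w *m b) *m w) *m val x \in Phi.
    by rewrite refl_group_root //; apply: valP.
  pose h : {ffun Phi -> Phi} := [ffun x : Phi => [` sP x]].
  have hE (x : Phi) : val (h x) = (reflmx (w *m b) *m w) *m val x.
    by rewrite ffunE.
  have : F g <= F h by apply: gmin; exists (reflmx (w *m b) *m w).
  rewrite (FE _ _ gE) (FE _ _ hE) leNgt => /negP; apply.
  have -> : dotv ((reflmx (w *m b) *m w)^T *m l) rho
      = dotv l (reflmx (w *m b) *m (w *m rho)).
    by rewrite dotv_mulmxl trmxK mulmxA.
  rewrite dotv_mulmxl trmxK reflmxE dotvBr dotvZr gtrBl.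
  rewrite !dotv_orthogonal ?(refl_group_orth wW) //.
  apply: mulr_gt0 => //; apply: divr_gt0; last exact/dotv_gt0/root_neq0.
  by apply: mulr_gt0 => //; apply: polar_sum_gt0.
exists (invmx w); first exact: RG_inv.
move=> a aP; rewrite invmxK; apply/idP/idP => [/wneg // | ].
apply: contraLR; rewrite -S_polar // => /wneg.
by rewrite mulmxN dotvNr oppr_lt0 -leNgt => /ltW.
Qed.

End Polarization.


(** * Simple reflections and freeness of the action *)

Section SimpleReflections.
Variable l : 'cV[R]_n.
Hypothesis l_regular : forall a, a \in Phi -> dotv l a != 0.

Lemma regular_lt0 a : a \in Phi -> (dotv l a < 0) = ~~ (0 < dotv l a).
Proof. by move=> aP; rewrite -leNgt le_eqVlt (negbTE (l_regular aP)). Qed.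

(** The usual definition, as an element of the base of the positive system, is
    replaced by the property that drives the exchange argument. *)
Definition simple_root a : Prop :=
  [/\ a \in Phi, 0 < dotv l a & forall b, b \in Phi -> 0 < dotv l b ->
     b != a -> 0 < dotv l (reflmx a *m b)].

Definition simple_word (s : seq 'cV[R]_n) : Prop :=
  forall a, a \in s -> simple_root a.

Definition wordmx (s : seq 'cV[R]_n) : 'M[R]_n :=
  foldr (fun a u => reflmx a *m u) 1%:M s.

Definition simply_generated u : Prop := exists2 s, simple_word s & u = wordmx s.

Lemma simple_word_cat s t :
  simple_word s -> simple_word t -> simple_word (s ++ t).
Proof. by move=> Ps Pt a; rewrite mem_cat => /orP[/Ps | /Pt]. Qed.

Lemma simple_word_cons a s :
  simple_word (a :: s) <-> simple_root a /\ simple_word s.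
Proof.
split=> [P | [Pa Ps] b].
  by split=> [|b bs]; apply: P; rewrite inE ?eqxx ?bs ?orbT.
by rewrite inE => /predU1P[-> | /Ps].
Qed.

Lemma wordmx_cat s t : wordmx (s ++ t) = wordmx s *m wordmx t.
Proof. by elim: s => [|a s IHs] /=; rewrite ?mul1mx // IHs mulmxA. Qed.

Lemma simply_generatedM u v :
  simply_generated u -> simply_generated v -> simply_generated (u *m v).
Proof.
move=> [s sS ->] [t tS ->]; exists (s ++ t); last by rewrite wordmx_cat.
exact: simple_word_cat.
Qed.

Lemma wordmx_rev s : wordmx (rev s) = (wordmx s)^T.
Proof.
elim: s => [|a s IHs] /=; first by rewrite trmx1.
by rewrite rev_cons -cats1 wordmx_cat /= mulmx1 IHs trmx_mul tr_reflmx.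
Qed.

Lemma simple_word_refl_group s : simple_word s -> in_refl_group Phi (wordmx s).
Proof.
elim: s => [|a s IHs] /=; first by move=> _; apply: RG_one.
move/simple_word_cons=> [[aP _ _] /IHs sW].
by apply: RG_mul => //; apply: RG_gen.
Qed.

(** The quantity dotv l x ^+ 2 / dotv x x is the squared height of the
    direction of x.  If b is not simple, some reflection x - c b of a positive
    root x is negative, so c b is the sum of the positive roots x and c b - x of
    equal length; let g be one of height at most half that of c b.  In the plane of b and g,
    g makes an acute angle with b, has lower direction, and reflecting b in g
    yields a root with height strictly between those of - b and b. *)
Lemma nonsimple_descent b : b \in Phi -> 0 < dotv l b -> ~ simple_root b ->
  exists g, [/\ g \in Phi,
    dotv l g ^+ 2 / dotv g g < dotv l b ^+ 2 / dotv b b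
    & dotv l (reflmx g *m b) ^+ 2 < dotv l b ^+ 2].
Proof.
move=> bP lb nsb; have bb := dotv_gt0 (root_neq0 bP).
(* dotv l g <= c / 2 * dotv l b, with denominators cleared *)
have [g [gP lg gb lgb]] : exists g, [/\ g \in Phi, 0 < dotv l g, g != b
    & dotv l g * dotv b b <= dotv g b * dotv l b].
  have [g [gP lg gb lsg]] : exists g, [/\ g \in Phi, 0 < dotv l g, g != b
      & dotv l (reflmx b *m g) < 0].
    apply: contrapT => no; apply: nsb; split=> // g gP lg gb.
    apply: contrapT => /negP; rewrite -regular_lt0; last exact: root_refl.
    by move=> lsg; apply: no; exists g.
  have E : dotv l (reflmx b *m g) * dotv b b
           = dotv l g * dotv b b - 2 * (dotv g b * dotv l b).
    rewrite reflmxE dotvBr dotvZr; field; exact: lt0r_neq0.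
  have [le_g | gt_g] := leP (dotv l g * dotv b b) (dotv g b * dotv l b).
    by exists g.
  exists (- (reflmx b *m g)); split.
  - exact/root_opp/root_refl.
  - by rewrite dotvNr oppr_gt0.
  - apply: contra gb; rewrite eqr_oppLR => /eqP sgb.
    rewrite -[g](reflmxK _ (root_neq0 bP)) sgb mulmxN.
    by rewrite reflmx_self ?opprK // root_neq0.
  - rewrite dotvNr dotvNl dotv_refl_root ?root_neq0 // opprK mulNr E.
    lra.
exists g; have gg := dotv_gt0 (root_neq0 gP).
have CS : dotv g b ^+ 2 < dotv g g * dotv b b.
  apply: CauchySchwarz_lt; last exact: root_neq0.
  move=> t; apply/eqP => gE; have := gP; rewrite gE.
  move/(root_proportional bP); rewrite -gE => -[/eqP | gNb].
    by rewrite (negbTE gb).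
  by move: lg; rewrite gNb dotvNr oppr_gt0 ltNge (ltW lb).
rewrite reflmxE dotvBr dotvZr (dotvC b g).
move: lb lg bb gg lgb CS.
move: (dotv l b) (dotv l g) (dotv b b) (dotv g g) (dotv g b) => A x B G k.
move=> A0 x0 B0 G0 xBkA kk; split=> //.
  rewrite ltr_pdivrMr // mulrAC ltr_pdivlMr //.
  have : (x * B) ^+ 2 <= (k * A) ^+ 2 by rewrite lerXn2r // nnegrE; nra.
  have : k ^+ 2 * A ^+ 2 < G * B * A ^+ 2 by rewrite ltr_pM2r // exprn_gt0.
  rewrite !exprMn => h1 h2; rewrite -(ltr_pM2r B0); lra.
have k0 : 0 < k.
  by rewrite -(pmulr_lgt0 _ A0); apply: lt_le_trans xBkA; rewrite mulr_gt0.
have kx : k * x < A * G.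
  rewrite -(ltr_pM2r B0) -mulrA; apply: le_lt_trans (ler_wpM2l (ltW k0) xBkA) _.
  by rewrite mulrA -expr2 mulrC -mulrA ltr_pM2l.
set y := 2 * k / G * x.
have y0 : 0 < y by rewrite mulr_gt0 // divr_gt0 // mulr_gt0.
have y2 : y < 2 * A.
  by rewrite /y mulrAC ltr_pdivrMr // -!mulrA ltr_pM2l.
have : 0 < y * (2 * A - y) by rewrite mulr_gt0 // subr_gt0.
lra.
Qed.

(** Take a root of smallest normalised height whose reflection is not a product
    of simple ones.  [nonsimple_descent] exhibits its reflection as
    s_g s_e s_g, where g and e = s_g b are both lower. *)
Lemma reflmx_simply_generated b : b \in Phi -> simply_generated (reflmx b).
Proof.
move=> bP; apply: contrapT => nb.
have [|x nx xmin] := @finite_minimum R Phi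
    (fun x : Phi => ~ simply_generated (reflmx (val x)))
    (fun x : Phi => dotv l (val x) ^+ 2 / dotv (val x) (val x)).
  by exists [` bP].
(* x may be replaced by - x, which has the same reflection and height *)
have [y [yE ly]] : exists y : Phi,
    (val y = val x \/ val y = - val x) /\ 0 < dotv l (val y).
  have xP := valP x.
  have [lx | lx] := boolP (0 < dotv l (val x)).
    by exists x; split; [left|].
  exists [` root_opp xP]; split; first by right.
  by rewrite /= dotvNr oppr_gt0 regular_lt0.
have yx : reflmx (val y) = reflmx (val x).
  by case: yE => ->; rewrite ?reflmxN.
have ny : dotv l (val y) ^+ 2 / dotv (val y) (val y)
          = dotv l (val x) ^+ 2 / dotv (val x) (val x).
  by case: yE => -> //; rewrite !dotvNr dotvNl opprK sqrrN.
have yP : val y \in Phi := valP y.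
have [sy | nsy] := pselect (simple_root (val y)).
  apply: nx; exists [:: val y]; last by rewrite /= mulmx1 yx.
  by move=> a; rewrite inE => /eqP ->.
have [g [gP gy sgy]] := nonsimple_descent yP ly nsy.
have small (h : Phi) : dotv l (val h) ^+ 2 / dotv (val h) (val h) <
    dotv l (val y) ^+ 2 / dotv (val y) (val y) ->
    simply_generated (reflmx (val h)).
  move=> lt_h; apply: contrapT => /xmin; rewrite -ny leNgt => /negP; exact.
have Gg : simply_generated (reflmx g) := small [` gP] gy.
have g0 := root_neq0 gP.
have Ge : simply_generated (reflmx (reflmx g *m val y)).
  apply: (small [` root_refl gP yP]) => /=.
  rewrite dotv_orthogonal ?tr_reflmx ?reflmxM //.
  by rewrite ltr_pM2r // invr_gt0 dotv_gt0 // root_neq0.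
apply: nx; rewrite -yx.
have -> : reflmx (val y) = reflmx g *m reflmx (reflmx g *m val y) *m reflmx g.
  rewrite reflmx_conj ?tr_reflmx ?reflmxM // !mulmxA reflmxM // mul1mx.
  by rewrite -mulmxA reflmxM // mulmx1.
by do 2!apply: simply_generatedM => //.
Qed.

Lemma refl_group_simply_generated u : in_refl_group Phi u -> simply_generated u.
Proof.
elim=> {u} [|a aP|u v _ uG _ vG|u uW [s sS uE]].
- by exists [::].
- exact: reflmx_simply_generated.
- exact: simply_generatedM.
exists (rev s); first by move=> a; rewrite mem_rev; apply: sS.
by rewrite wordmx_rev -uE orthogonal_invmx // refl_group_orth.
Qed.

(** Apply the letters of the word to a, starting from the right: some letter s_g
    turns a positive root into a negative one, which by simplicity of g means
    that the root is g.  So s_g is conjugate to s_a by the letters to its right,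
    and multiplying by s_a on the right deletes that letter. *)
Lemma exchange s a : simple_word s -> simple_root a ->
  dotv l (wordmx s *m a) < 0 ->
  exists t, [/\ simple_word t, (size t).+1 = size s
              & wordmx s *m reflmx a = wordmx t].
Proof.
move=> + [aP la _]; elim: s => [|g s IHs] /=.
  by rewrite mul1mx ltNge (ltW la).
move/simple_word_cons=> [sg ss]; have [gP lg gE] := sg.
have sW := simple_word_refl_group ss.
have saP : wordmx s *m a \in Phi by rewrite refl_group_root.
have [lsa _ | lsa] := boolP (dotv l (wordmx s *m a) < 0).
  have [t [tS tsz tE]] := IHs ss lsa.
  exists (g :: t); split=> /=; [exact/simple_word_cons | by rewrite tsz |].
  by rewrite -tE mulmxA.
rewrite -mulmxA => lgsa; exists s; split=> //.
move: lsa; rewrite regular_lt0 // negbK => lsa.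
have sag : wordmx s *m a = g.
  apply/eqP; apply: contraLR lgsa => /(gE _ saP lsa).
  by rewrite -leNgt => /ltW.
have ss1 := refl_group_orth sW.
rewrite -sag reflmx_conj // -!mulmxA (mulmxA (wordmx s)^T) ss1 mul1mx.
by rewrite reflmxM ?mulmx1 // root_neq0.
Qed.

(** A nonempty word that preserves positivity can be shortened by two letters:
    the word without its last letter s_a sends a to a negative root, so
    [exchange] applies to it. *)
Lemma refl_group_free u : in_refl_group Phi u ->
  (forall a, a \in Phi -> 0 < dotv l a -> 0 < dotv l (u *m a)) -> u = 1%:M.
Proof.
case/refl_group_simply_generated=> s + ->.
move: {2}(size s).+1 (ltnSn (size s)) => k; elim: k s => // k IHk s.
case/lastP: s => [//|s a]; rewrite size_rcons ltnS => szk saS pos.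
have sE : wordmx (rcons s a) = wordmx s *m reflmx a.
  by rewrite -cats1 wordmx_cat /= mulmx1.
have aS : simple_root a by apply: saS; rewrite mem_rcons mem_head.
have sS : simple_word s by move=> b bs; apply: saS; rewrite mem_rcons inE bs orbT.
have [aP la _] := aS.
have [|t [tS tsz tE]] := exchange sS aS.
  have := pos a aP la.
  by rewrite sE -mulmxA reflmx_self ?root_neq0 // mulmxN dotvNr oppr_gt0.
rewrite sE tE; apply: IHk => // [|b bP lb].
  by apply: leq_trans szk; rewrite -tsz ltnW.
by rewrite -tE -sE; apply: pos.
Qed.

End SimpleReflections.

End RootSystem.

(** * Closed Condorcet domains *)

Lemma sum_pred1_nat (T : finType) (P : pred T) (u : T) :
  (\sum_(x | P x) (x == u) = P u)%N.
Proof.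
have [Pu | nPu] := boolP (P u).
  by rewrite (bigD1 u) //= eqxx big1 // => x /andP[_ /negbTE ->].
by rewrite big1 // => x Px; case: eqP => // xu; rewrite -xu Px in nPu.
Qed.

Section ClosedDomain.
Local Open Scope fset_scope.
Local Open Scope ring_scope.
Variables (R : realType) (n : nat) (Phi : {fset 'cV[R]_n}).
Implicit Types (a b c : 'cV[R]_n).
Hypothesis Phi_roots : root_system Phi.
Variable l : 'cV[R]_n.
Hypothesis l_regular : forall a, a \in Phi -> dotv l a != 0.

Let Phip := [fset a in Phi | 0 < dotv l a].
Let I (w : 'M[R]_n) := inversions Phi Phip w.

Lemma refl_group_inv_root u a : in_refl_group Phi u ->
  (invmx u *m a \in Phi) = (a \in Phi).
Proof. by move/RG_inv => uW; rewrite refl_group_root. Qed.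

Lemma inversionsE u a : in_refl_group Phi u ->
  (a \in I u) = (a \in Phi) && (dotv l (invmx u *m a) < 0).
Proof.
move=> uW; rewrite /I /inversions /Phip !inE /=.
rewrite refl_group_inv_root //; have [aP | //] := boolP (a \in Phi).
by rewrite andbT (regular_lt0 l_regular) // refl_group_inv_root.
Qed.

Lemma inversions_opp u a : in_refl_group Phi u -> a \in Phi ->
  (- a \in I u) = (a \notin I u).
Proof.
move=> uW aP; rewrite !inversionsE // root_opp // aP /= mulmxN dotvNr oppr_lt0.
by rewrite (regular_lt0 l_regular) ?negbK // refl_group_inv_root.
Qed.

Lemma inversions_no_relation u a b c r s t : in_refl_group Phi u ->
  a \in I u -> b \in I u -> c \in I u -> 0 < r -> 0 < s -> 0 < t ->
  r *: a + s *: b + t *: c <> 0.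
Proof.
move=> uW; rewrite !inversionsE // => /andP[_ la] /andP[_ lb] /andP[_ lc].
move=> r0 s0 t0 /(congr1 (fun x => dotv l (invmx u *m x))).
rewrite mulmx0 dotv0r !mulmxDr !dotvDr -!scalemxAr !dotvZr.
move=> E; suff : r * dotv l (invmx u *m a) + s * dotv l (invmx u *m b)
    + t * dotv l (invmx u *m c) < 0 by rewrite E ltxx.
by rewrite -oppr_gt0 !opprD !addr_gt0 // oppr_gt0 pmulr_rlt0.
Qed.

Lemma inversions_inj u v : in_refl_group Phi u -> in_refl_group Phi v ->
  I u `<=` I v -> u = v.
Proof.
move=> uW vW /fsubsetP uv.
have vuW : in_refl_group Phi (invmx v *m u) by apply: RG_mul => //; apply: RG_inv.
have vE := orthogonal_invmx (refl_group_orth Phi_roots vW).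
have vv := orthogonal_trmx (refl_group_orth Phi_roots vW).
suff : invmx v *m u = 1%:M.
  by move/(congr1 (mulmx v)); rewrite mulmxA vE vv mul1mx mulmx1.
apply: (refl_group_free Phi_roots l_regular vuW) => a aP la.
have uaP : u *m a \in Phi by rewrite refl_group_root.
have : - (u *m a) \in I u.
  rewrite inversionsE // root_opp //= mulmxN dotvNr oppr_lt0.
  have uu := refl_group_orth Phi_roots uW.
  by rewrite mulmxA orthogonal_invmx // uu mul1mx.
by move/uv; rewrite inversionsE // mulmxN dotvNr oppr_lt0 -mulmxA => /andP[].
Qed.

Variable D : {fset 'M[R]_n}.
Hypothesis D_closed : closed_condorcet_domain Phi Phip D.

Lemma domain_refl_group (u : D) : in_refl_group Phi (val u).
Proof. by case: D_closed => -[_ DW _] _; apply: DW; apply: valP. Qed.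

Definition ballots (u v w : D) : D -> nat :=
  fun x => ((x == u) + (x == v) + (x == w))%N.

Lemma total_ballots u v w : total_votes (ballots u v w) = 3%N.
Proof.
by rewrite /total_votes !big_split /= !(sum_pred1_nat predT).
Qed.

Lemma votes_ballots u v w a : votes Phi Phip (ballots u v w) a
  = ((a \in I (val u)) + (a \in I (val v)) + (a \in I (val w)))%N.
Proof.
by rewrite /votes !big_split /=
  !(sum_pred1_nat (fun x : D => a \in inversions Phi Phip (val x))).
Qed.

Lemma no_tie_ballots u v w : no_tie Phi Phip (ballots u v w).
Proof.
move=> a _; rewrite total_ballots votes_ballots; apply/eqP => E.
have /eqP : (((a \in I (val u)) + (a \in I (val v)) + (a \in I (val w))) * 2)%N%:R
    = 3%:R :> R by rewrite natrM E divfK // pnatr_eq0.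
by rewrite eqr_nat; do 3!case: (a \in _).
Qed.

Lemma majority_ballots u v w a :
  (a \in majority Phi Phip (ballots u v w)) = (a \in Phi) &&
    [|| (a \in I (val u)) && (a \in I (val v)),
        (a \in I (val v)) && (a \in I (val w))
      | (a \in I (val w)) && (a \in I (val u))].
Proof.
have -> : (a \in majority Phi Phip (ballots u v w)) = (a \in Phi) &&
    ((total_votes (ballots u v w))%:R / 2
       <= (votes Phi Phip (ballots u v w) a)%:R :> R).
  by rewrite /majority !inE.
rewrite total_ballots votes_ballots; congr (_ && _).
rewrite ler_pdivrMr ?ltr0n // -natrM ler_nat.
by do 3!case: (a \in _).
Qed.

Lemma majority_polar u v w a : a \in Phi ->
  (- a \in majority Phi Phip (ballots u v w))
    = (a \notin majority Phi Phip (ballots u v w)).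
Proof.
move=> aP; rewrite !majority_ballots root_opp // aP /=.
rewrite !inversions_opp //; try exact: domain_refl_group.
by do 3!case: (a \in _).
Qed.

(** Each member of the triple misses at most one of the three ballots, and each
    ballot misses at least one member, because all roots of an inversion set lie
    on the same side of a hyperplane.  So ballots and members are matched
    bijectively, which is the configuration that a Condorcet domain excludes. *)
Lemma majority_no_triple u v w a b c :
  u != v -> u != w -> v != w ->
  a \in majority Phi Phip (ballots u v w) ->
  b \in majority Phi Phip (ballots u v w) ->
  c \in majority Phi Phip (ballots u v w) -> ~ root_triple Phi a b c.
Proof.
move=> uv uw vw aS bS cS abc.
have nall (x : D) :
    ~~ [&& a \in I (val x), b \in I (val x) & c \in I (val x)].
  apply/and3P => -[ax bx cx]; have [_ _ [r [s [t [r0 s0 t0]]]]] := abc.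
  by apply: inversions_no_relation ax bx cx r0 s0 t0; apply: domain_refl_group.
have nsplit (x y z : D) : x != y -> x != z -> y != z ->
    ~~ [&& a \in I (val x), b \in I (val x), a \in I (val y),
           c \in I (val y), b \in I (val z) & c \in I (val z)].
  move=> xy xz yz; apply/negP => /and5P[ax bx ay cy /andP[bz cz]].
  case: D_closed => -[_ _ noD] _; apply: noD.
  exists (val x), (val y), (val z), a, b, c; split=> //.
  - by split; apply: valP.
  - by split; apply/fsubsetP => d; rewrite in_fset2 => /orP[] /eqP ->.
have [vu wu wv] : [/\ v != u, w != u & w != v] by split; rewrite eq_sym.
have := nsplit u v w uv uw vw; have := nsplit u w v uw uv wv.
have := nsplit v u w vu vw uw; have := nsplit v w u vw vu wu.
have := nsplit w u v wu wv uv; have := nsplit w v u wv wu vu.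
have := nall u; have := nall v; have := nall w.
move: aS bS cS; rewrite !majority_ballots => /andP[_ +] /andP[_ +] /andP[_ +].
do 3!case: (a \in _) => //=; do 3!case: (b \in _) => //=;
  by do 3!case: (c \in _).
Qed.

Lemma domain_median (u v w : D) : exists m : D, forall a, a \in Phi ->
  (a \in I (val m)) = [|| (a \in I (val u)) && (a \in I (val v)),
        (a \in I (val v)) && (a \in I (val w))
      | (a \in I (val w)) && (a \in I (val u))].
Proof.
have [<- | uv] := eqVneq u v.
  by exists u => a _; do 2!case: (a \in _).
have [<- | uw] := eqVneq u w.
  by exists u => a _; do 2!case: (a \in _).
have [<- | vw] := eqVneq v w.
  by exists v => a _; do 2!case: (a \in _).
have [||| x xW xE] := polar_inversions Phi_roots
    (S := majority Phi Phip (ballots u v w)) _ _ _ l_regular.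
- by apply/fsubsetP => a; rewrite majority_ballots => /andP[].
- exact: majority_polar.
- by move=> a b c; apply: majority_no_triple.
have IxE a : a \in Phi ->
    (a \in I x) = (a \in majority Phi Phip (ballots u v w)).
  by move=> aP; rewrite inversionsE // aP xE.
have xD : x \in D.
  case: D_closed => _; move/(congr1 (fun A => A x)) => /= <-.
  exists (ballots u v w); split=> //.
  - by exists u; rewrite /ballots eqxx.
  - exact: no_tie_ballots.
  - apply/fsubsetP => a ax.
    have aP : a \in Phi by move: ax; rewrite inversionsE // => /andP[].
    by rewrite -IxE.
by exists [` xD] => a aP; rewrite /= IxE // majority_ballots aP.
Qed.

End ClosedDomain.

Theorem theorem1p5 (R : realType) (n : nat) (Phi Phip : {fset 'cV[R]_n})
    (D : {fset 'M[R]_n}) :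
  root_system Phi -> positive_system Phi Phip ->
  closed_condorcet_domain Phi Phip D ->
  median_graph (assoc_graph Phi Phip D).
Proof.
move=> Phi_roots [l [l_regular ->]].
set Phip' := [fset a in Phi | _]%fset => D_closed.
pose half (a : Phi) : {set D} :=
  [set x : D | val a \in inversions Phi Phip' (val x)].
have DW := domain_refl_group D_closed.
have halfC (a : Phi) (x : D) : (- val a \in inversions Phi Phip' (val x))
    = (val a \notin inversions Phi Phip' (val x)).
  by apply: inversions_opp => //; apply: valP.
have IP (x : D) a : a \in inversions Phi Phip' (val x) -> a \in Phi.
  by rewrite inversionsE // => /andP[].
apply: (@halfspaces_median_graph (assoc_graph Phi Phip' D) (half @: [set: Phi])).
- move=> H /imsetP[a _ ->]; apply/imsetP.
  exists [` root_opp Phi_roots (valP a)]%fset => //.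
  by apply/setP => x; rewrite in_setC !in_set /= halfC.
- move=> a b ab; apply: val_inj.
  apply: (inversions_inj Phi_roots l_regular) => //.
  apply/fsubsetP => c ca; have cP := IP _ _ ca.
  by have := ab (half [` cP]%fset); rewrite !in_set imset_f // => /(_ isT ca).
- move=> a b c; have [m mE] := domain_median Phi_roots l_regular D_closed a b c.
  by exists m => H /imsetP[d _ ->]; rewrite !in_set mE //; apply: valP.
- move=> a b; rewrite /edge /= /neighbors; congr (_ && ~~ _).
  apply: eq_existsb => v; congr [&& _, _ & _].
  apply/fsubsetP/betweenP => [btw H /imsetP[d _ ->] | btw d].
    by rewrite !in_set => da db; apply: btw; rewrite in_fsetI da db.
  rewrite in_fsetI => /andP[da db]; have dP := IP _ _ da.
  by have := btw (half [` dP]%fset); rewrite !in_set imset_f // => /(_ isT da db).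
Qed.
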